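(* Let $\ell$ and $m$ be positive integers with $2\le\ell<m$, let $G$ be a torsion-free group (not necessarily abelian), written multiplicatively with identity $1$, and let $\mathcal{A}=(A_1,\dots,A_m)$ be a sequence of finite subsets of $G$ with $|A_i|\ge2$ for each $i\in[1,m]$. Let $A=A_1\cup\cdots\cup A_m$. Assume that $\mu_{\mathcal{A}}(a)=\ell$ for some $a\in A$, that $|\{a\in A:\mu_{\mathcal{A}}(a)\ge2\}|\ge2$, and that \[ |\Pi^{\ell}(\mathcal{A})|=\sum_{a\in A}\mu_{\mathcal{A}}(a)-\ell+1 . \] For $j\in[1,\ell]$ let $A'_j=\{a\in A:\mu_{\mathcal{A}}(a)\ge j\}$, and let $k$ be the largest integer such that $|A'_j|\ge2$ for each $j\in[1,k]$. Then there exist $g\in G$ with $g\ne1$ and $\alpha_j,\beta_j\in G$ such that for each $j\in[1,k]$ the set $A'_j$ is a geometric progression of type $(\alpha_j,g,\beta_j)$, and $\alpha_{j+1}=\beta_j^{-1}$ for each $j\in[1,k-1]$.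
   Context: $\chi_S$ is the indicator function of $S$; $\mu_{\mathcal{A}}(a)=\min\big(\ell,\sum_{j=1}^m\chi_{A_j}(a)\big)$ for $a\in A$. $\Pi^{\ell}(\mathcal{A})$ is the set of all products $a_{i_1}\cdots a_{i_\ell}$ with $i_1,\dots,i_\ell\in[1,m]$ pairwise distinct (in any order) and $a_{i_j}\in A_{i_j}$. A nonempty finite set $B\subseteq G$ is a geometric progression of type $(a,g,b)$ ($a,b,g\in G$, $g\neq1$) if $B=\{ab,agb,\dots,ag^{|B|-1}b\}$. *)

(* Defs.v *)
From HB Require Import structures.
From mathcomp Require Import all_boot.
From mathcomp Require Import monoid finmap.

Set Implicit Arguments.
Unset Strict Implicit.
Unset Printing Implicit Defensive.

Local Open Scope fset_scope.
Local Open Scope group_scope.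

Section Defs.
Variable G : groupType.

Definition torsion_free : Prop :=
  forall (x : G) (n : nat), (0 < n)%N -> x ^+ n = 1 -> x = 1.

Variable m : nat.
Variable A : 'I_m -> {fset G}.

Definition Aunion : {fset G} := \bigcup_(i | true) A i.

Definition mu (l : nat) (a : G) : nat :=
  minn l (\sum_(i < m) (a \in A i)).

(* Pi^l(A): products a_{i_1} ... a_{i_l}, i_1..i_l pairwise distinct
   (any order), a_{i_j} ∈ A_{i_j}.  A choice is a pair (f, x) with
   f : 'I_l -> 'I_m injective and x j ∈ A (f j). *)
Definition Pi_prod (l : nat)
  (p : {ffun 'I_l -> 'I_m} * {ffun 'I_l -> Aunion}) : G :=
  \prod_(j < l) val (p.2 j).

Definition Pi_ok (l : nat)
  (p : {ffun 'I_l -> 'I_m} * {ffun 'I_l -> Aunion}) : bool :=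
  injectiveb p.1 && [forall j, val (p.2 j) \in A (p.1 j)].

Definition Pi (l : nat) : {fset G} :=
  [fset @Pi_prod l p | p in [pred p | @Pi_ok l p]].

Definition Aprime (l j : nat) : {fset G} :=
  [fset a in Aunion | (j <= mu l a)%N].

End Defs.

Definition geom_prog (G : groupType) (B : {fset G}) (a g b : G) : Prop :=
  B != fset0 /\ g != 1 /\
  B =i [seq a * g ^+ i * b | i <- iota 0 #|` B|].

(* Main.v *)
(* An element of [Aprime A l j] lies in at least [j] of the sets, so distinct
   sets can be chosen greedily for the factors and the product
   A'_1 A'_2 ... A'_l is contained in Pi^l(A).  Kemperman's bound
   |XY| >= |X| + |Y| - 1 shows that this product already has at least
   sum |A'_j| - l + 1 elements; the hypothesis thus forces
   |A'_j A'_{j+1}| = |A'_j| + |A'_{j+1}| - 1 for each j.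
   For sets with at least two elements, equality makes both factors progressions
   with a common ratio (Brailovsky-Freiman), and the ratio is carried along the
   chain because A'_{j+1} is determined up to a right translation by the ratio
   of A'_j.  Both facts on products are proved by Hamidoune's method: atoms
   meet in few points, so in a torsion-free group a 1-atom is a point and a
   2-atom has two elements. *)
Require Import Defs.
From Stdlib Require Import Classical_Prop.
From HB Require Import structures.
From mathcomp Require Import all_boot.
From mathcomp Require Import monoid finmap zify.

Local Open Scope fset_scope.
Local Open Scope group_scope.

(** Descent on [f x]. Whether a smaller value occurs is decided classically, since the candidates
    will be all finite subsets of a possibly infinite group. *)
Lemma ex_argmin (T : Type) (P : T -> Prop) (f : T -> nat) (x : T) :
  P x -> exists y, P y /\ forall z, P z -> (f y <= f z)%N.
Proof.
have [n] := ubnP (f x); elim: n x => // n IHn x ltn Px.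
have [[y [Py lt_yx]]|no_y] := classic (exists y, P y /\ (f y < f x)%N).
  by apply: IHn Py; lia.
exists x; split=> // z Pz; rewrite leqNgt; apply/negP => lt_zx.
by apply: no_y; exists z.
Qed.

(** * Product sets, translates and inverses *)

Section ProductSets.
Set Implicit Arguments.
Unset Strict Implicit.
Variable G : groupType.
Implicit Types (X Y A B : {fset G}) (g u x y a b : G).

Definition prodfs X Y : {fset G} := [fset x * y | x in X, y in Y].
Local Notation "X ** Y" := (prodfs X Y) (at level 40, left associativity).

Lemma prodfsP X Y z :
  reflect (exists x y, [/\ x \in X, y \in Y & z = x * y]) (z \in X ** Y).
Proof.
apply: (iffP (imfset2P _ _ _ _ _)) => [[x xX [y yY ->]]|[x [y [xX yY ->]]]].
  by exists x, y.
by exists x => //; exists y.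
Qed.

Lemma mem_prodfs X Y x y : x \in X -> y \in Y -> x * y \in X ** Y.
Proof. by move=> xX yY; apply/prodfsP; exists x, y. Qed.

Lemma prodfsA : associative prodfs.
Proof.
move=> X Y Z; apply/fsetP => t; apply/prodfsP/prodfsP.
  move=> [x [_ [xX /prodfsP[y [z [yY zZ ->]]] ->]]].
  by exists (x * y), z; rewrite mulgA mem_prodfs.
move=> [_ [z [/prodfsP[x [y [xX yY ->]]] zZ ->]]].
by exists x, (y * z); rewrite mulgA mem_prodfs.
Qed.

Lemma mem_lcosetfs g X y : (y \in [fset g] ** X) = (g^-1 * y \in X).
Proof.
apply/prodfsP/idP => [[h [x [/fset1P-> xX ->]]]|gyX]; first by rewrite mulKg.
by exists g, (g^-1 * y); rewrite mulVKg inE eqxx.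
Qed.

Lemma mem_rcosetfs g X y : (y \in X ** [fset g]) = (y * g^-1 \in X).
Proof.
apply/prodfsP/idP => [[x [h [xX /fset1P-> ->]]]|gyX]; first by rewrite mulgK.
by exists (y * g^-1), g; rewrite mulgVK inE eqxx.
Qed.

Lemma prod1fs : left_id [fset 1] prodfs.
Proof. by move=> X; apply/fsetP => y; rewrite mem_lcosetfs invg1 mul1g. Qed.

Lemma prodfs1 : right_id [fset 1] prodfs.
Proof. by move=> X; apply/fsetP => y; rewrite mem_rcosetfs invg1 mulg1. Qed.

Lemma card_lcosetfs g X : #|` [fset g] ** X| = #|` X|.
Proof.
suff -> : [fset g] ** X = [fset g * x | x in X] by rewrite card_imfset //; exact: mulgI.
apply/fsetP => y; rewrite mem_lcosetfs; apply/idP/imfsetP => [gyX|[x xX ->]].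
  by exists (g^-1 * y); rewrite ?mulVKg.
by rewrite mulKg.
Qed.

Lemma card_rcosetfs g X : #|` X ** [fset g]| = #|` X|.
Proof.
suff -> : X ** [fset g] = [fset x * g | x in X] by rewrite card_imfset //; exact: mulIg.
apply/fsetP => y; rewrite mem_rcosetfs; apply/idP/imfsetP => [gyX|[x xX ->]].
  by exists (y * g^-1); rewrite ?mulgVK.
by rewrite mulgK.
Qed.

Lemma prodfsSS X X' Y Y' : X `<=` X' -> Y `<=` Y' -> X ** Y `<=` X' ** Y'.
Proof.
move=> /fsubsetP sX /fsubsetP sY; apply/fsubsetP => _ /prodfsP[x [y [xX yY ->]]].
by rewrite mem_prodfs ?sX ?sY.
Qed.

Lemma prodfsUl X Y B : (X `|` Y) ** B = (X ** B) `|` (Y ** B).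
Proof.
apply/eqP; rewrite eqEfsubset fsubUset !prodfsSS ?fsubsetUl ?fsubsetUr // !andbT.
apply/fsubsetP => _ /prodfsP[x [b [/fsetUP[] xXY bB ->]]].
  by apply/fsetUP; left; apply: mem_prodfs.
by apply/fsetUP; right; apply: mem_prodfs.
Qed.

Lemma prodfsUr B X Y : B ** (X `|` Y) = (B ** X) `|` (B ** Y).
Proof.
apply/eqP; rewrite eqEfsubset fsubUset !prodfsSS ?fsubsetUl ?fsubsetUr // !andbT.
apply/fsubsetP => _ /prodfsP[b [x [bB /fsetUP[] xXY ->]]].
  by apply/fsetUP; left; apply: mem_prodfs.
by apply/fsetUP; right; apply: mem_prodfs.
Qed.

(** The union is sent to the union of the two products, and the intersection into their
    intersection. This submodularity is what lets minimisers be intersected. *)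
Lemma card_prodfs_submod X Y B :
  (#|` (X `&` Y) ** B| + #|` (X `|` Y) ** B| <= #|` X ** B| + #|` Y ** B|)%N.
Proof.
rewrite prodfsUl -(cardfsUI (X ** B) (Y ** B)) addnC leq_add2l fsubset_leq_card //.
by rewrite fsubsetI !prodfsSS ?fsubsetIl ?fsubsetIr.
Qed.

Lemma card_prodfs_ge X B : B != fset0 -> (#|` X| <= #|` X ** B|)%N.
Proof.
move=> /fset0Pn[b bB]; rewrite -(card_rcosetfs b X) fsubset_leq_card // prodfsSS //.
by rewrite fsub1set.
Qed.

Definition invfs X : {fset G} := [fset x^-1 | x in X].

Lemma mem_invfs X y : (y \in invfs X) = (y^-1 \in X).
Proof.
apply/imfsetP/idP => [[x xX ->]|yX]; first by rewrite invgK.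
by exists y^-1; rewrite ?invgK.
Qed.

Lemma invfsK : involutive invfs.
Proof. by move=> X; apply/fsetP => x; rewrite !mem_invfs invgK. Qed.

Lemma card_invfs X : #|` invfs X| = #|` X|.
Proof. by rewrite card_imfset //; exact: invg_inj. Qed.

Lemma invfsM X Y : invfs (X ** Y) = invfs Y ** invfs X.
Proof.
apply/fsetP => z; rewrite mem_invfs; apply/prodfsP/prodfsP => [[x [y [xX yY e]]]|].
  by exists y^-1, x^-1; rewrite !mem_invfs !invgK -invgM -e invgK.
move=> [y [x [yY xX ->]]]; rewrite !mem_invfs in xX yY.
by exists x^-1, y^-1; rewrite invgM.
Qed.

(** * Atoms *)

(* Hamidoune's [k]-atoms of [B]: the sets of size at least [k] that minimise
   [#|` X ** B| - #|` X|], and have minimal size among the minimisers. *)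
Definition atom k B X := (k <= #|` X|)%N /\ forall Y, (k <= #|` Y|)%N ->
  (#|` X ** B| + #|` Y| <= #|` Y ** B| + #|` X|)%N /\
  (#|` X ** B| + #|` Y| = #|` Y ** B| + #|` X| -> #|` X| <= #|` Y|)%N.

(** Two successive minimisations; [card_prodfs_ge] guarantees that the natural-number differences
    are not truncated. *)
Lemma atom_exists k B X : B != fset0 -> (k <= #|` X|)%N -> exists Y, atom k B Y.
Proof.
move=> B0 kX; have leB Y := card_prodfs_ge Y B0.
have [Y [kY minY]] := @ex_argmin _ (fun Y => is_true (k <= #|` Y|)%N)
  (fun Y => #|` Y ** B| - #|` Y|)%N _ kX.
have [Z [[kZ eZ] minZ]] := @ex_argmin _ (fun Z => (k <= #|` Z|)%N /\
   (#|` Z ** B| - #|` Z| = #|` Y ** B| - #|` Y|)%N) (fun Z => #|` Z|)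
   _ (conj kY erefl).
exists Z; split=> // T kT.
have := minY _ kT; have := leB Y; have := leB Z; have := leB T => lT lZ lY m1.
split; first by lia.
by move=> eT; apply: minZ; split=> //; lia.
Qed.

(** Both the union and the intersection are admissible competitors, so submodularity makes the
    intersection a minimiser too; minimality of size then equates it with [X] and with [Y]. *)
Lemma atom_meet_eq k B X Y :
  atom k B X -> atom k B Y -> (k <= #|` X `&` Y|)%N -> X = Y.
Proof.
move=> [kX aX] [kY aY] kXY.
have kXUY : (k <= #|` X `|` Y|)%N.
  by rewrite (leq_trans kX) // fsubset_leq_card // fsubsetUl.
have sm := card_prodfs_submod X Y B; have cUI := cardfsUI X Y.
have [X1 X2] := aX _ kXY; have [X3 _] := aX _ kXUY.
have [Y1 Y2] := aY _ kXY; have [Y3 _] := aY _ kXUY.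
have [XY1 _] := aX _ kY; have [YX1 _] := aY _ kX.
have lX : (#|` X| <= #|` X `&` Y|)%N by apply: X2; lia.
have lY : (#|` Y| <= #|` X `&` Y|)%N by apply: Y2; lia.
have /eqP <- : X `&` Y == X by rewrite eqEfcard fsubsetIl.
by apply/eqP; rewrite eqEfcard fsubsetIr.
Qed.

Lemma atom_lcoset k B X g : atom k B X -> atom k B ([fset g] ** X).
Proof. by rewrite /atom -prodfsA !card_lcosetfs. Qed.

(** * Torsion-free groups: Kemperman's bound and Sidon atoms *)

Hypothesis tf : torsion_free G.

Lemma expg_inj u : u != 1 -> injective (fun n => u ^+ n).
Proof.
move=> u1 i j; wlog ij : i j / (i < j)%N => [wl e|e].
  by have [/wl|/wl|//] := ltngtP i j => ->.
case/eqP: u1; apply: (tf (n := (j - i)%N)); first by rewrite subn_gt0.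
by rewrite expgnFr 1?ltnW // -e mulgV.
Qed.

(** Pigeonhole: the points [u ^+ n * x] are pairwise distinct, so a finite set cannot hold them
    all. *)
Lemma expg_escape u X x : u != 1 -> exists n, u ^+ n * x \notin X.
Proof.
move=> u1; apply: NNPP => noN.
have uX n : u ^+ n * x \in X by apply/negP => /negP uX; apply: noN; exists n.
have : injective (fun i : 'I_(#|` X|.+1) => [` uX i] : X).
  by move=> i j /(congr1 val)/= /mulIg/(expg_inj u1)/val_inj.
by move=> /leq_card; rewrite card_ord -cardfE ltnn.
Qed.

Lemma lcosetfs_free g X : X != fset0 -> [fset g] ** X = X -> g = 1.
Proof.
move=> /fset0Pn[x xX] gX; apply/eqP/negP => /negP g1.
have [n /negP] := expg_escape X x g1; apply.
by elim: n => [|n IHn]; rewrite ?expg0 ?mul1g // expgS -mulgA -gX mem_prodfs ?inE.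
Qed.

(* A [1]-atom is a left coset of its own stabiliser, hence a point. *)
Lemma kemperman X B : X != fset0 -> B != fset0 ->
  (#|` X| + #|` B| <= #|` X ** B|.+1)%N.
Proof.
move=> X0 B0; have X1 : (1 <= #|` X|)%N by rewrite cardfs_gt0.
have [M aM] := atom_exists B0 X1; have [M1 /(_ _ X1)[mM _]] := aM.
have M0 : M != fset0 by rewrite -cardfs_gt0.
suff cM : #|` M| = 1%N.
  have /cardfs1P[x eM] : #|` M| == 1%N by apply/eqP.
  by move: mM; rewrite eM card_lcosetfs cardfs1; lia.
have [x xM] := fset0Pn _ M0.
suff /eqP -> : M == [fset x] by rewrite cardfs1.
(* Translation by [y * x^-1] gives an atom that shares [y] with [M], hence equals [M]; freeness of
   translation then yields [y = x]. *)
rewrite eqEfsubset fsub1set xM andbT; apply/fsubsetP => y yM; rewrite inE -divg_eq1.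
apply/eqP/(lcosetfs_free M0)/(atom_meet_eq (k := 1) (B := B)) => //.
  exact: atom_lcoset.
rewrite cardfs_gt0; apply/fset0Pn; exists y.
by rewrite inE yM mem_lcosetfs invgF mulgVK xM.
Qed.

(** Equivalently, each [g != 1] has at most one representation [x * y^-1] with [x] and [y] in
    [X]. *)
Definition sidon X := forall g, g != 1 -> (#|` ([fset g] ** X) `&` X| <= 1)%N.

(** A left translate of a 2-atom is a 2-atom; two common points would make it equal to [M], which
    only the trivial translation allows. *)
Lemma atom2_sidon B M : atom 2 B M -> sidon M.
Proof.
move=> aM g; apply: contraNT; rewrite -ltnNge => h; apply/eqP.
apply: (@lcosetfs_free _ M); last exact: atom_meet_eq (atom_lcoset g aM) aM h.
by rewrite -cardfs_gt0; case: aM => /ltnW.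
Qed.

Lemma cardfs_gt1P X :
  reflect (exists x y, [/\ x \in X, y \in X & x != y]) (1 < #|` X|)%N.
Proof.
apply: (iffP idP) => [X1|[x [y [xX yX xy]]]]; last first.
  have -> : 2 = #|` [fset x; y]| by rewrite cardfs2 xy.
  by rewrite fsubset_leq_card // fsubUset !fsub1set xX.
have /fset0Pn[x xX] : X != fset0 by rewrite -cardfs_gt0 ltnW.
have /fset0Pn[y] : X `\ x != fset0.
  by rewrite -cardfs_gt0; move: X1; rewrite (cardfsD1 x) xX.
by rewrite !inE => /andP[yx yX]; exists x, y; rewrite eq_sym.
Qed.

(** * Geometric progressions and products with a pair *)

Definition geomfs u n : {fset G} := [fset u ^+ i | i in iota 0 n].

Lemma mem_geomfs u n y : reflect (exists2 i, (i < n)%N & y = u ^+ i) (y \in geomfs u n).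
Proof.
by apply: (iffP (imfsetP _ _ _ _)) => -[i lt_in ->]; exists i; move: lt_in;
   rewrite /= ?mem_iota.
Qed.

Lemma card_geomfs u n : u != 1 -> #|` geomfs u n| = n.
Proof.
move=> u1; rewrite card_imfset /=; last exact: expg_inj.
by rewrite undup_id ?iota_uniq ?size_iota.
Qed.

Lemma geomfsSl u n : (0 < n)%N -> geomfs u n.+1 = [fset 1; u] ** geomfs u n.
Proof.
move=> n0; apply/fsetP => y; apply/mem_geomfs/prodfsP.
  move=> [[|i] lt_in ->].
    by exists 1, 1; rewrite mulg1 !inE eqxx; split=> //; apply/mem_geomfs; exists 0%N.
  exists u, (u ^+ i); rewrite -expgS !inE eqxx orbT; split=> //.
  by apply/mem_geomfs; exists i.
move=> [x [_ [/fset2P[]-> /mem_geomfs[i lt_in ->] ->]]].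
  by exists i; rewrite ?mul1g //; lia.
by exists i.+1; rewrite -?expgS.
Qed.

Lemma geomfsSr u n : (0 < n)%N -> geomfs u n.+1 = geomfs u n ** [fset 1; u].
Proof.
move=> n0; rewrite geomfsSl //; apply/fsetP => y; apply/prodfsP/prodfsP.
  move=> [x [_ [x1u /mem_geomfs[i lt_in ->] ->]]].
  exists (u ^+ i), x; split=> //; first by apply/mem_geomfs; exists i.
  by move: x1u => /fset2P[]->; rewrite ?mulg1 ?mul1g // -expgS expgSr.
move=> [_ [x [/mem_geomfs[i lt_in ->] x1u ->]]].
exists x, (u ^+ i); split=> //; first by apply/mem_geomfs; exists i.
by move: x1u => /fset2P[]->; rewrite ?mulg1 ?mul1g // -expgS expgSr.
Qed.

(** The bound leaves just one point [b] of [B] outside [u * B], so every run of multiplications by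
    [u] inside [B] starts at [b]. *)
Lemma geom_of_pairl u B : u != 1 -> B != fset0 ->
  (#|` [fset 1%g; u] ** B| <= #|` B|.+1)%N -> exists b, B = geomfs u #|` B| ** [fset b].
Proof.
move=> u1 B0; set uB := [fset u] ** B.
have -> : [fset 1; u] ** B = B `|` uB by rewrite prodfsUl prod1fs.
have cUI := cardfsUI B uB; have cID := cardfsID uB B.
rewrite card_lcosetfs in cUI => cU.
have /fset0Pn[b] : B `\` uB != fset0.
  rewrite fsetD_eq0; apply: contraNN u1 => BuB; apply/eqP/(lcosetfs_free B0)/eqP.
  by rewrite eq_sym eqEfcard BuB card_lcosetfs /=.
rewrite inE => /andP[buB bB].
have start x : x \in B -> u^-1 * x \notin B -> x = b.
  move=> xB xuB; have : (#|` B `\` uB| <= 1)%N by lia.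
  move=> c1; apply/eqP; apply: contraLR c1 => xb; rewrite -ltnNge.
  apply: (@leq_trans #|` [fset x; b]|); first by rewrite cardfs2 xb.
  apply: fsubset_leq_card; apply/fsubsetP => z /fset2P[]->; rewrite inE ?buB ?bB //.
  by rewrite mem_lcosetfs xuB.
have [n0 n0B n0min] : exists2 n, u ^+ n * b \notin B & forall i, (i < n)%N -> u ^+ i * b \in B.
  have [n nB minn] := ex_minnP (expg_escape B b u1).
  by exists n => // i; apply: contraTT => /minn; rewrite -leqNgt.
have eB : B = geomfs u n0 ** [fset b].
  apply/fsetP => x; rewrite mem_rcosetfs; apply/idP/mem_geomfs; last first.
    by move=> [i lt_i e]; rewrite -(mulgVK b x) e n0min.
  (* Stepping back from [x] by [u^-1] eventually leaves [B]; the last point inside is a start, hence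
     [b], so [x] is [u ^+ n * b]. *)
  move=> xB; have uV1 : u^-1 != 1 by rewrite invg_eq1.
  have [[|n] nB minn] := ex_minnP (expg_escape B x uV1); first by rewrite expg0 mul1g xB in nB.
  have inB i : (i <= n)%N -> u^-1 ^+ i * x \in B.
    by move=> le_in; apply: contraTT le_in => /minn; rewrite -ltnNge.
  have eb : u^-1 ^+ n * x = b by apply: start; rewrite ?inB // mulgA -expgS.
  have ex i : (i <= n)%N -> u ^+ i * b = u^-1 ^+ (n - i) * x.
    move=> le_in; rewrite -eb -{1}(subnKC le_in) expgnDr !expVgn.
    by rewrite -!mulgA mulVKg.
  exists n; last by rewrite -(mulgK b (u ^+ n)) ex // subnn expg0 mul1g.
  (* If [n0 <= n], the backward run would contain [u ^+ n0 * b], the first point outside [B]. *)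
  rewrite ltnNge; apply: contra n0B => le_n; rewrite ex //.
  by apply: inB; rewrite leq_subr.
exists b; rewrite {1}eB; congr (geomfs _ _ ** _).
by rewrite eB card_rcosetfs card_geomfs.
Qed.

Lemma invfs_pair u : invfs [fset 1; u] = [fset 1; u^-1].
Proof. by rewrite /invfs imfset_fset2 invg1. Qed.

(** Inversion exchanges the two sides and replaces [u] by [u^-1]. *)
Lemma geom_of_pairr u B : u != 1 -> B != fset0 ->
  (#|` B ** [fset 1%g; u]| <= #|` B|.+1)%N -> exists a, B = [fset a] ** geomfs u #|` B|.
Proof.
move=> u1 B0; rewrite -card_invfs invfsM invfs_pair -(card_invfs B).
case/geom_of_pairl; first by rewrite invg_eq1.
  by rewrite -cardfs_gt0 card_invfs cardfs_gt0.
move=> b; rewrite card_invfs => e; exists b^-1; rewrite -{1}(invfsK B) {}e.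
apply/fsetP => y; rewrite mem_invfs mem_rcosetfs mem_lcosetfs invgK -invgM.
apply/mem_geomfs/mem_geomfs => -[i lt_i e]; exists i => //.
  by apply: invg_inj; rewrite e expVgn.
by rewrite e expVgn.
Qed.

(** Split off one factor [[fset 1; u]] from the progression. Kemperman's bound for the remaining
    [n - 1] terms against [[fset 1; u] ** B] leaves the pair an excess of at most one. *)
Lemma pair_of_geoml u B a n : u != 1 -> B != fset0 -> (2 <= n)%N ->
  (#|` ([fset a] ** geomfs u n) ** B| < n + #|` B|)%N ->
  (#|` [fset 1%g; u] ** B| <= #|` B|.+1)%N.
Proof.
case: n => [|[|n]] // u1 B0 _; rewrite geomfsSr // -!prodfsA card_lcosetfs.
have := @kemperman (geomfs u n.+1) ([fset 1; u] ** B).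
rewrite -!cardfs_gt0 card_geomfs //.
have := @card_prodfs_ge [fset 1; u] B B0; rewrite cardfs2 => h1 h2.
have := h2 erefl; lia.
Qed.

Lemma pair_of_geomr u X b n : u != 1 -> X != fset0 -> (2 <= n)%N ->
  (#|` X ** (geomfs u n ** [fset b])| < #|` X| + n)%N ->
  (#|` X ** [fset 1%g; u]| <= #|` X|.+1)%N.
Proof.
case: n => [|[|n]] // u1 X0 _; rewrite geomfsSl // !prodfsA card_rcosetfs.
have := @kemperman (X ** [fset 1; u]) (geomfs u n.+1).
have := @card_prodfs_ge X [fset 1; u].
rewrite -!cardfs_gt0 card_geomfs // cardfs2 => h1 h2.
have := h1 erefl; rewrite -cardfs_gt0 in X0 => h3.
have := h2 _ erefl; lia.
Qed.

(** * Two-element atoms and the Brailovsky-Freiman theorem *)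

(** Common points [p != q] would put [p * y^-1] and [p * y'^-1] both in [X] and in its left
    translate by [p * q^-1]. *)
Lemma sidonr X y y' : sidon X -> y != y' ->
  (#|` (X ** [fset y]) `&` (X ** [fset y'])| <= 1)%N.
Proof.
move=> sX; apply: contraNT; rewrite -ltnNge => /cardfs_gt1P.
move=> [p [q [+ + pq]]]; rewrite !inE !mem_rcosetfs => /andP[p1 p2] /andP[q1 q2].
have : p * q^-1 != 1 by rewrite divg_eq1.
move=> /sX; apply: contraTT => yy'; rewrite -ltnNge; apply/cardfs_gt1P.
exists (p * y^-1), (p * y'^-1); rewrite !inE !mem_lcosetfs !invgF !mulgA !mulgVK.
rewrite p1 p2 q1 q2; split=> //; apply: contraNN yy' => /eqP/mulgI/invg_inj->.
by [].
Qed.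

Lemma sidon_pair X y y' : sidon X -> y != y' ->
  (2 * #|` X| <= #|` X ** [fset y; y']|.+1)%N.
Proof.
move=> sX yy'; rewrite prodfsUr.
have := cardfsUI (X ** [fset y]) (X ** [fset y']); rewrite !card_rcosetfs.
have := sidonr sX yy'; lia.
Qed.

(** Each of the three pairwise overlaps costs at most one point. *)
Lemma sidon_triple X x y z : sidon X -> x != y -> x != z -> y != z ->
  (3 * #|` X| <= #|` X ** [fset x; y; z]| + 3)%N.
Proof.
move=> sX xy xz yz; rewrite prodfsUr.
have := cardfsUI (X ** [fset x; y]) (X ** [fset z]).
rewrite card_rcosetfs {2}prodfsUr fsetIUl.
have := cardfsUI (X ** [fset x] `&` (X ** [fset z])) (X ** [fset y] `&` (X ** [fset z])).
have := sidon_pair sX xy; have := sidonr sX xz; have := sidonr sX yz; lia.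
Qed.

(* Let [M] be a [2]-atom of [B] and [N] a [2]-atom of [M] on the other side.
   Both are Sidon sets while [M ** N] is as small as possible, which leaves
   room for two elements only. *)
Lemma card_atom2 A B : (2 <= #|` A|)%N -> (2 <= #|` B|)%N ->
  (#|` A ** B| < #|` A| + #|` B|)%N ->
  exists M : {fset G}, #|` M| = 2 /\ (#|` M ** B| <= #|` B|.+1)%N.
Proof.
move=> A2 B2 AB.
have B0 : B != fset0 by rewrite -cardfs_gt0 ltnW.
have [M aM] := atom_exists B0 A2; have [M2 /(_ _ A2)[MB _]] := aM.
have IM0 : invfs M != fset0 by rewrite -cardfs_gt0 card_invfs ltnW.
(* Atoms act on the left, so the other side is reached by inversion; [invfs B] serves as the
   competitor. *)
have [|N' aN] := @atom_exists 2 (invfs M) (invfs B) IM0; first by rewrite card_invfs.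
have [N'2 /(_ (invfs B))[]] := aN; first by rewrite card_invfs.
rewrite -invfsM !card_invfs => N'M _.
have sM := atom2_sidon aM; have sN := atom2_sidon aN.
have /cardfs_gt1P[x [y [xN yN xy]]] := N'2.
have [u [v [uM vM uv]]] := cardfs_gt1P _ M2.
have cMN : #|` N' ** invfs M| = #|` M ** invfs N'|.
  by rewrite -card_invfs invfsM invfsK.
have sub2 (T : {fset G}) a b : a \in T -> b \in T -> [fset a; b] `<=` T.
  by move=> aT bT; rewrite fsubUset !fsub1set aT.
have inI (T : {fset G}) a : a \in T -> a^-1 \in invfs T by rewrite mem_invfs invgK.
have xyV : x^-1 != y^-1 by rewrite eqg_inv.
have uvV : u^-1 != v^-1 by rewrite eqg_inv.
have ub : (#|` N' ** invfs M| < #|` M| + #|` N'|)%N.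
  by move: AB MB N'M; clear; lia.
(* Two points of one set already give almost twice the size of the other; against [ub] this forces
   equal sizes. *)
have leNM : (#|` M| <= #|` N'|)%N.
  have sub := sub2 _ _ _ (inI _ _ xN) (inI _ _ yN).
  have := fsubset_leq_card (prodfsSS (fsubset_refl M) sub).
  by rewrite -cMN => le; move: (leq_trans (sidon_pair sM xyV) (leq_ltn_trans le ub)); clear; lia.
have leMN : (#|` N'| <= #|` M|)%N.
  have sub := sub2 _ _ _ (inI _ _ uM) (inI _ _ vM).
  have le := fsubset_leq_card (prodfsSS (fsubset_refl N') sub).
  by move: (leq_trans (sidon_pair sN uvV) (leq_ltn_trans le ub)); clear; lia.
have eMN : #|` N'| = #|` M| by apply/eqP; rewrite eqn_leq leMN.
exists M; suff eM : #|` M| = 2 by split=> //; move: AB MB; rewrite eM; clear; lia.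
(* With common size [c], a third point would give [3c - 3 <= 2c - 1], that is [c <= 2]. *)
apply/eqP; rewrite eqn_leq M2 andbT leqNgt; apply/negP => M3.
have /fset0Pn[w] : invfs M `\` [fset u^-1; v^-1] != fset0.
  by rewrite -cardfs_gt0 cardfsDS ?sub2 ?inI // card_invfs cardfs2 uvV subn_gt0.
rewrite !inE negb_or => /andP[/andP[wu wv] wM].
have sub3 : [fset u^-1; v^-1; w] `<=` invfs M.
  by rewrite fsubUset fsub1set wM andbT sub2 ?inI.
rewrite eq_sym in wu; rewrite eq_sym in wv.
have : (3 * #|` N'| <= #|` N' ** invfs M| + 3)%N.
  rewrite (leq_trans (sidon_triple sN uvV wu wv)) // leq_add2r.
  exact: fsubset_leq_card (prodfsSS (fsubset_refl N') sub3).
by move: ub M3; rewrite eMN; clear; lia.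
Qed.

(** The two-element atom is a translate of [[fset 1; u]], which makes [B] a progression of ratio
    [u]; [B] in turn gives the pair bound for [A]. *)
Lemma brailovsky_freiman A B : (2 <= #|` A|)%N -> (2 <= #|` B|)%N ->
  (#|` A ** B| < #|` A| + #|` B|)%N ->
  exists u a b, [/\ u != 1, A = [fset a] ** geomfs u #|` A|
                         & B = geomfs u #|` B| ** [fset b]].
Proof.
move=> A2 B2 AB.
have A0 : A != fset0 by rewrite -cardfs_gt0 ltnW.
have B0 : B != fset0 by rewrite -cardfs_gt0 ltnW.
have [M [cM MB]] := card_atom2 A2 B2 AB.
have /cardfs_gt1P[x [y [xM yM xy]]] : (1 < #|` M|)%N by rewrite cM.
have eM : M = [fset x] ** [fset 1; x^-1 * y].
  have -> : [fset x] ** [fset 1; x^-1 * y] = [fset x; y].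
    rewrite prodfsUr; apply/fsetP => z; rewrite !inE !mem_lcosetfs !inE.
    by rewrite mulg_eq1 eqg_inv eq_sym (inj_eq (mulgI _)).
  apply/eqP; rewrite eq_sym eqEfcard cardfs2 xy cM andbT.
  by rewrite fsubUset !fsub1set xM.
have u1 : x^-1 * y != 1 by rewrite mulg_eq1 eqg_inv.
move: MB; rewrite eM -prodfsA card_lcosetfs => /(geom_of_pairl u1 B0)[b eB].
move: AB; rewrite {1}eB => /(pair_of_geomr u1 A0 B2)/(geom_of_pairr u1 A0)[a eA].
by exists (x^-1 * y), a, b.
Qed.

(** * Products of several sets and chains of progressions *)

Definition prodfseq (s : seq {fset G}) : {fset G} := foldr prodfs [fset 1] s.

Lemma prodfseq_cat s1 s2 : prodfseq (s1 ++ s2) = prodfseq s1 ** prodfseq s2.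
Proof. by elim: s1 => [|X s1 IHs] /=; rewrite ?prod1fs // IHs prodfsA. Qed.

Lemma kemperman_seq s : all (fun X => X != fset0) s ->
  (0 < #|` prodfseq s|)%N /\
  (\sum_(X <- s) #|` X| < #|` prodfseq s| + size s)%N.
Proof.
elim: s => [|X s IHs] /=; first by rewrite big_nil cardfs1.
move=> /andP[X0 /IHs[P0 ltP]]; rewrite big_cons; have := X0; rewrite -cardfs_gt0.
have := @kemperman X (prodfseq s) X0; rewrite -cardfs_gt0 => /(_ P0).
move: (\sum_(_ <- s) _) ltP => S; move: #|` _| #|` X| (#|` prodfs _ _|) (size s) P0 => *; lia.
Qed.

(** Merging [X] and [Y] into one factor keeps the product but shortens the list by one, so
    Kemperman's bound for the merged list limits [X ** Y]. *)
Lemma consecutive_critical s1 X Y s2 (s := s1 ++ X :: Y :: s2) :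
  all (fun X => X != fset0) s ->
  (#|` prodfseq s| + size s <= (\sum_(X <- s) #|` X|).+1)%N ->
  (#|` X ** Y| < #|` X| + #|` Y|)%N.
Proof.
rewrite /s all_cat /= => /andP[s1_0 /and3P[X0 Y0 s2_0]].
have [|_] := @kemperman_seq (s1 ++ (X ** Y) :: s2).
  rewrite all_cat s1_0 /= s2_0 andbT -cardfs_gt0.
  by rewrite (leq_trans _ (card_prodfs_ge X Y0)) // cardfs_gt0.
have -> : prodfseq (s1 ++ X ** Y :: s2) = prodfseq (s1 ++ X :: Y :: s2).
  by rewrite !prodfseq_cat /= !prodfsA.
rewrite !size_cat !big_cat !big_cons /=; move: (prodfseq _) => P.
move: (\sum_(_ <- s1) _) (\sum_(_ <- s2) _) #|` P| #|` X ** Y| => *; lia.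
Qed.

Lemma mem_prodfseq (F : nat -> {fset G}) k n z :
  z \in prodfseq [seq F j | j <- iota k n] ->
  exists2 a : nat -> G, forall j, (j < n)%N -> a j \in F (k + j)%N
                      & z = \prod_(j < n) a j.
Proof.
elim: n k z => [|n IHn] k z /=.
  by rewrite inE => /eqP->; exists (fun _ => 1); rewrite ?big_ord0.
move=> /prodfsP[x [_ [xF /IHn[a aF ->] ->]]].
exists (fun j => if j is j'.+1 then a j' else x).
  by case=> [|j] lt_j; rewrite ?addn0 // -addSnnS aF.
by rewrite big_ord_recl.
Qed.

Lemma prodfs_fset1 a b : [fset a] ** [fset b] = [fset a * b].
Proof. by apply/fsetP => z; rewrite mem_rcosetfs !inE divg_eq. Qed.

(** Here [g ^ b] is the conjugate [b^-1 * g * b], not a power. *)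
Lemma geomfs_conj g b n : geomfs g n ** [fset b] = [fset b] ** geomfs (g ^ b) n.
Proof.
apply/fsetP => z; rewrite mem_rcosetfs mem_lcosetfs.
apply/mem_geomfs/mem_geomfs => -[i lt_i e]; exists i => //.
  by rewrite -conjXg -e conjgE mulgVK.
by apply: (mulgI b^-1); rewrite mulgA e -conjXg conjgE !mulgA mulgK.
Qed.

Lemma geom_prog_geomfs g a b B : g != 1 -> B != fset0 ->
  B = [fset a] ** geomfs g #|` B| ** [fset b] -> geom_prog B a g b.
Proof.
move=> g1 B0 eB; split=> //; split=> // x; rewrite {1}eB mem_rcosetfs mem_lcosetfs.
apply/mem_geomfs/mapP => [[i lt_i e]|[i + ->]].
  by exists i; rewrite ?mem_iota // -e mulVKg mulgVK.
by rewrite mem_iota => lt_i; exists i; rewrite // mulgK mulKg.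
Qed.

(** If [F j] has type [(alpha, g, beta)], it is also a left translate of a progression of ratio
    [g ^ beta]. Hence the next set is a progression of that ratio times some [b], which is of type
    [(beta^-1, g, beta * b)]. *)
Lemma geom_chain (F : nat -> {fset G}) k :
  (2 <= k)%N -> (forall j, (1 <= j <= k)%N -> (2 <= #|` F j|)%N) ->
  (forall j, (1 <= j < k)%N -> (#|` F j ** F j.+1| < #|` F j| + #|` F j.+1|)%N) ->
  exists2 g, g != 1 & exists alpha beta : nat -> G,
    (forall j, (1 <= j <= k)%N ->
       F j = [fset alpha j] ** geomfs g #|` F j| ** [fset beta j]) /\
    (forall j, (1 <= j < k)%N -> alpha j.+1 = (beta j)^-1).
Proof.
move=> k2 F2 crit.
(* The first pair serves only to fix [g] and the form of [F 1]; all later sets, [F 2] included, come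
   from the induction. *)
have [|||g [a [_ [g1 eF1 _]]]] := @brailovsky_freiman (F 1%N) (F 2).
- by apply: F2; lia.
- by apply: F2; lia.
- by apply: crit; lia.
exists g => //.
suff H n : (1 <= n <= k)%N -> exists alpha beta : nat -> G,
    (forall j, (1 <= j <= n)%N ->
       F j = [fset alpha j] ** geomfs g #|` F j| ** [fset beta j]) /\
    (forall j, (1 <= j < n)%N -> alpha j.+1 = (beta j)^-1).
  by apply: H; rewrite leqnn ltnW.
elim: n => [//|[_ _|n IHn le_n]].
  exists (fun=> a), (fun=> 1); split=> j; last by lia.
  move=> j1; have -> : j = 1%N by lia.
  by rewrite prodfs1.
have [|alpha [beta [eF eab]]] := IHn; first by lia.
have Fn2 : (2 <= #|` F n.+1|)%N by rewrite F2 //; lia.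
have Fn0 : F n.+2 != fset0 by rewrite -cardfs_gt0 ltnW // F2 //; lia.
have gb1 : g ^ beta n.+1 != 1 by rewrite conjg_eq1.
have : (#|` F n.+1 ** F n.+2| < #|` F n.+1| + #|` F n.+2|)%N by rewrite crit //; lia.
rewrite {1}(eF n.+1) ?leqnn // -(prodfsA [fset alpha _]) geomfs_conj prodfsA prodfs_fset1.
move=> /(pair_of_geoml gb1 Fn0 Fn2)/(geom_of_pairl gb1 Fn0)[b eFn].
exists (fun j => if j == n.+2 then (beta n.+1)^-1 else alpha j).
exists (fun j => if j == n.+2 then beta n.+1 * b else beta j).
split=> j le_j.
  have [->|jn] := eqVneq j n.+2; last by apply: eF; lia.
  rewrite {1}eFn -prodfs_fset1 -(prodfsA _ (geomfs _ _)) (prodfsA (geomfs _ _)) (geomfs_conj g).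
  by rewrite !prodfsA prodfs_fset1 mulVg prod1fs.
have -> : (j == n.+2) = false by lia.
have [[->]//|jn] := eqVneq j.+1 n.+2; apply: eab; lia.
Qed.

End ProductSets.

(** * Level sets of the multiplicity *)

Section LevelSets.
Set Implicit Arguments.
Unset Strict Implicit.
Variables (G : groupType) (l m : nat) (A : 'I_m -> {fset G}).
Implicit Types (j : nat) (a : G).

Lemma mem_Aunion i a : a \in A i -> a \in Aunion A.
Proof. by move=> aA; apply/bigfcupP; exists i; rewrite ?mem_index_enum. Qed.

Lemma mem_Aprime j a : (0 < j)%N -> (a \in Aprime A l j) = (j <= mu A l a)%N.
Proof.
move=> j0; rewrite !inE /= andb_idl //; rewrite /mu leq_min => /andP[_ j_le].
have [i] : exists i, a \in A i; last exact: mem_Aunion.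
apply/existsP; apply: contraLR j_le; rewrite negb_exists => /forallP noi.
by rewrite big1 -?ltnNge // => i _; rewrite (negPf (noi i)).
Qed.

(** Double counting: [mu A l a] is the number of [j] in [[1, l]] with [j <= mu A l a]. *)
Lemma sum_mu : \sum_(a <- Aunion A) mu A l a = \sum_(1 <= j < l.+1) #|` Aprime A l j|.
Proof.
transitivity (\sum_(a <- Aunion A) \sum_(1 <= j < l.+1 | (j <= mu A l a)%N) 1)%N.
  apply: eq_bigr => a _.
  have mul : (mu A l a <= l)%N by rewrite geq_minl.
  rewrite -{1}[mu A l a]subn0 -(subSS 0) -[LHS]muln1 -sum_nat_const_nat.
  by rewrite [RHS]big_nat_cond (big_nat_widen _ _ l.+1) //= [LHS]big_nat_cond;
    apply: eq_bigl => j; rewrite ltnS; case: (j <= _)%N; rewrite ?andbT ?andbF.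
rewrite (exchange_big_dep xpredT) //=; apply: eq_big_nat => j /andP[j1 _].
rewrite sum1_count -size_filter.
apply/perm_size/uniq_perm; rewrite ?filter_uniq ?fset_uniq // => a.
by rewrite mem_filter mem_Aprime // andb_idr // -(mem_Aprime a j1) inE => /andP[].
Qed.

Lemma prod_Aprime_sub_Pi : (l < m)%N ->
  prodfseq [seq Aprime A l j | j <- iota 1 l] `<=` Pi A l.
Proof.
move=> lm; apply/fsubsetP => z /mem_prodfseq[a aA ->].
(* Only a default value for [nth]. *)
have i0 : 'I_m := Ordinal lm.
have [s [us ss sA]] : exists s : seq 'I_m, [/\ uniq s, size s = l &
    forall j, (j < l)%N -> a j \in A (nth i0 s j)].
  suff H n : (n <= l)%N -> exists s : seq 'I_m, [/\ uniq s, size s = n &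
    forall j, (j < n)%N -> a j \in A (nth i0 s j)] by apply: H.
  elim: n => [_|n IHn lt_n]; first by exists [::].
  have [s [us ss sA]] := IHn (ltnW lt_n).
  have := aA n lt_n; rewrite mem_Aprime // /mu leq_min => /andP[_].
  (* The element [a n] lies in at least [n + 1] sets and only [n] indices are taken, so a fresh one
     remains. *)
  move=> mu_n; have /subsetPn[i iA is_] : ~~ ([pred i | a n \in A i] \subset s).
    apply: contraL mu_n => /subset_leq_card le_s.
    rewrite add1n -leqNgt; have := card_size s; rewrite ss; apply: leq_trans.
    apply: leq_trans le_s; rewrite -sum1_card [leqRHS]big_mkcond leq_sum // => h _.
  exists (rcons s i); rewrite rcons_uniq us is_ size_rcons ss; split=> // j.
  rewrite ltnS leq_eqVlt nth_rcons ss => /predU1P[->|lt_j]; last by rewrite lt_j sA.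
  by rewrite ltnn eqxx.
have aU (j : 'I_l) : a j \in Aunion A by apply: mem_Aunion (sA j (ltn_ord j)).
apply/imfsetP; exists ([ffun j : 'I_l => nth i0 s j], [ffun j : 'I_l => [` aU j]]) => /=.
  rewrite /Pi_ok /=; apply/andP; split; last by apply/forallP => j; rewrite !ffunE sA.
  apply/injectiveP => i j; rewrite !ffunE => /eqP; rewrite nth_uniq ?ss // => /eqP.
  exact: val_inj.
by rewrite /Pi_prod; apply: eq_bigr => j _; rewrite /= ffunE.
Qed.

End LevelSets.

(** * Equality for the product of the level sets *)

Theorem theorem1p18 (l m : nat) (G : groupType) (A : 'I_m -> {fset G}) :
  (2 <= l)%N -> (l < m)%N ->
  torsion_free G ->
  (forall i : 'I_m, (2 <= #|` A i|)%N) ->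
  (exists2 a, a \in Aunion A & mu A l a = l) ->
  (2 <= #|` Aprime A l 2|)%N ->
  #|` Pi A l| = ((\sum_(a <- Aunion A) mu A l a) - l + 1)%N ->
  forall k : nat,
    (k <= l)%N ->
    (forall j, (1 <= j <= k)%N -> (2 <= #|` Aprime A l j|)%N) ->
    ((k < l)%N -> (#|` Aprime A l k.+1| < 2)%N) ->
  exists g : G, g != 1 /\
    exists alpha beta : nat -> G,
      (forall j, (1 <= j <= k)%N ->
         geom_prog (Aprime A l j) (alpha j) g (beta j)) /\
      (forall j, (1 <= j <= k.-1)%N -> alpha j.+1 = (beta j)^-1).
Proof.
move=> l2 lm tf _ [a0 a0A mu_a0] A2 cardPi k kl kA kmax.
(* The first level contains the second, so both have two elements and maximality excludes [k = 0]
   and [k = 1]. *)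
have k2 : (2 <= k)%N.
  have A1 : (#|` Aprime A l 2| <= #|` Aprime A l 1|)%N.
    apply: fsubset_leq_card; apply/fsubsetP => a; rewrite !mem_Aprime //; lia.
  by case: k kl kA kmax => [|[|k]] // _ _ /(_ ltac:(lia)); lia.
pose s := [seq Aprime A l j | j <- iota 1 l].
(* The element [a0] of multiplicity [l] lies in every level. *)
have s0 : all (fun X => X != fset0) s.
  apply/allP => _ /mapP[j + ->]; rewrite mem_iota => /andP[j1 jl].
  by apply/fset0Pn; exists a0; rewrite mem_Aprime // mu_a0; lia.
have sum_s : \sum_(X <- s) #|` X| = \sum_(a <- Aunion A) mu A l a.
  by rewrite sum_mu big_map /index_iota subn1.
(* This makes the subtraction of [l] in [cardPi] a true one. *)
have l_le : (l <= \sum_(X <- s) #|` X|)%N.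
  rewrite -{1}(size_iota 1 l) -(size_map (Aprime A l)) -/s -sum1_size.
  rewrite !(big_seq_cond xpredT) leq_sum // => X /andP[Xs _].
  by rewrite cardfs_gt0 (allP s0).
have le_s : (#|` prodfseq s| + size s <= (\sum_(X <- s) #|` X|).+1)%N.
  have := fsubset_leq_card (prod_Aprime_sub_Pi A lm); rewrite cardPi -/s.
  have := l_le; rewrite sum_s size_map size_iota.
  move: (\sum_(_ <- _) _) => S; move: #|` prodfseq s| => P; lia.
have crit j : (1 <= j < k)%N -> (#|` prodfs (Aprime A l j) (Aprime A l j.+1)|
    < #|` Aprime A l j| + #|` Aprime A l j.+1|)%N.
  move=> jk; have es : s = [seq Aprime A l i | i <- iota 1 j.-1] ++ Aprime A l j ::
      Aprime A l j.+1 :: [seq Aprime A l i | i <- iota j.+2 (l - j.+1)].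
    have el : (l = j.-1 + (l - j.+1).+2)%N by lia.
    by rewrite /s {2}el iotaD map_cat add1n prednK //; lia.
  by move: s0 le_s; rewrite es; apply: consecutive_critical.
have [g g1 [alpha [beta [eA ab]]]] := geom_chain tf k2 kA crit.
exists g; split=> //; exists alpha, beta; split=> j jk; last by apply: ab; lia.
by apply: geom_prog_geomfs => //; [rewrite -cardfs_gt0 ltnW // kA|exact: eA].
Qed.
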